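(* Let $\mathcal{L}$ be the $NT\times NT$ supra-Laplacian of a temporal network with $T\ge 3$ layers and $N$ nodes following the periodic constant block Jacobi model, with diagonal blocks $\widetilde{L}$ and inter-layer blocks $\widetilde{L}_W$ (as defined in the context). Then the spectrum of $\mathcal{L}$, counted with multiplicities, coincides with the union (as multisets, i.e. with multiplicities added) of the spectra of the $N\times N$ matrices $\widetilde{L}+2\cos\left(k\frac{2\pi}{T}\right)\widetilde{L}_W$, $k=0,1,\dots,T-1$: $$\mathrm{spec}(\mathcal{L})=\bigcup_{k=0}^{T-1}\mathrm{spec}\left(\widetilde{L}+2\cos\left(k\tfrac{2\pi}{T}\right)\widetilde{L}_W\right).$$
   Context: Periodic constant block Jacobi model. Let $A$ be the $N\times N$ adjacency matrix (binary, symmetric) of a connected undirected graph on $N$ nodes, with degrees $d_i=\sum_{j=1}^N A_{ij}$ and degree matrix $D=\mathrm{diag}(d_1,\dots,d_N)$. Let $W=\mathrm{diag}(\omega_1,\dots,\omega_N)$ be a real diagonal matrix of inter-layer weights, with $d_i+2\omega_i>0$ for all $i$ (often $\omega_i=\omega$ for all $i$, i.e. $W=\omega I$). There are $T\geq 3$ layers, each with adjacency matrix $A$, and consecutive layers are coupled by $W$ periodically (layer $T$ is also coupled with layer $1$). The supra-adjacency matrix $\mathcal{A}$ is the $T\times T$ block matrix with $N\times N$ blocks whose diagonal blocks equal $A$, whose $(t,p)$ block equals $W$ whenever $p\equiv t\pm1 \pmod T$, and whose other blocks are zero. The multilayer degree of node $i$ in every layer is $d_i+2\omega_i$, and $\mathcal{D}$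 is the block diagonal matrix with all $T$ diagonal blocks equal to $D+2W$. The normalized supra-Laplacian is $\mathcal{L}=\mathcal{D}^{-1/2}(\mathcal{D}-\mathcal{A})\mathcal{D}^{-1/2}$. Thus $\mathcal{L}$ is the $T\times T$ block matrix whose diagonal blocks are $$\widetilde{L}=I-(D+2W)^{-1/2}A(D+2W)^{-1/2},$$ whose $(t,p)$ blocks with $p\equiv t\pm 1\pmod T$ (including the upper-right and lower-left corner blocks) are $$\widetilde{L}_W=-(D+2W)^{-1/2}W(D+2W)^{-1/2},$$ which for $W=\omega I$ equals $-\omega(D+2\omega I)^{-1}$, and whose other blocks are zero. *)

(* Defs.v *)
From HB Require Import structures.
From mathcomp Require Import all_boot all_order all_algebra.
From mathcomp Require Import all_reals trigo.
From mathcomp Require Import complex.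

Set Implicit Arguments.
Unset Strict Implicit.
Unset Printing Implicit Defensive.

Import Order.TTheory GRing.Theory Num.Theory.
Local Open Scope ring_scope.

Section Spectrum.
Variable R : realType.

(* The multiset (a sequence up to perm_eq) of the complex eigenvalues of a real
   matrix, repeated according to their algebraic multiplicities; sval picks one
   ordering of the roots, hence only perm_eq statements are meaningful. *)
Definition spectrum n (M : 'M[R]_n) : seq R[i] :=
  sval (closed_field_poly_normal (char_poly (map_mx (real_complex R) M))).

Lemma char_poly_spectrum n (M : 'M[R]_n) :
  char_poly (map_mx (real_complex R) M) =
  \prod_(z <- spectrum M) ('X - z%:P).
Proof.
rewrite /spectrum; case: closed_field_poly_normal => s /= {1}->.
by rewrite (monicP (char_poly_monic _)) scale1r.
Qed.

Lemma mem_spectrum n (M : 'M[R]_n) z :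
  (z \in spectrum M) = eigenvalue (map_mx (real_complex R) M) z.
Proof. by rewrite eigenvalue_root_char char_poly_spectrum root_prod_XsubC. Qed.

End Spectrum.

Section PeriodicJacobi.
Variables (R : realType) (N : nat).

Definition connected_graph (e : rel 'I_N) := forall i j, connect e i j.

Definition adjacency (e : rel 'I_N) : 'M[R]_N := \matrix_(i, j) (e i j)%:R.

Definition degree (A : 'M[R]_N) : 'rV[R]_N := \row_i \sum_j A i j.

(* M^(-1/2) for a diagonal matrix M with positive diagonal entries *)
Definition diag_invsqrt n (M : 'M[R]_n) : 'M[R]_n :=
  diag_mx (\row_i (Num.sqrt (M i i))^-1).

Definition multidegree (A : 'M[R]_N) (w : 'rV[R]_N) : 'M[R]_N :=
  diag_mx (degree A) + 2 *: diag_mx w.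

(* p = t + 1 or p = t - 1 modulo T *)
Definition adjacent_layers T (t p : 'I_T) : bool :=
  (p == t.+1 %[mod T]) || (p.+1 == t %[mod T]).

Definition supra_adjacency T (A : 'M[R]_N) (w : 'rV[R]_N)
    : 'M[R]_(\sum_(t < T) N) :=
  \mxblock_(t < T, p < T)
    (if t == p then A else if adjacent_layers t p then diag_mx w else 0).

Definition supra_degree T (A : 'M[R]_N) (w : 'rV[R]_N)
    : 'M[R]_(\sum_(t < T) N) :=
  \mxdiag_(t < T) multidegree A w.

Definition supra_laplacian T (A : 'M[R]_N) (w : 'rV[R]_N)
    : 'M[R]_(\sum_(t < T) N) :=
  let Dinv := diag_invsqrt (supra_degree T A w) in
  Dinv *m (supra_degree T A w - supra_adjacency T A w) *m Dinv.

Definition layer_block (A : 'M[R]_N) (w : 'rV[R]_N) : 'M[R]_N :=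
  let Dinv := diag_invsqrt (multidegree A w) in
  1%:M - Dinv *m A *m Dinv.

Definition interlayer_block (A : 'M[R]_N) (w : 'rV[R]_N) : 'M[R]_N :=
  let Dinv := diag_invsqrt (multidegree A w) in
  - (Dinv *m diag_mx w *m Dinv).

End PeriodicJacobi.

(* Main.v *)
(* Positivity of the multilayer degrees makes the normalized supra-Laplacian a
   block-circulant matrix with blocks L on the diagonal and M between cyclically
   adjacent layers. The block Fourier matrix, with (t, k) block z^(tk) I for a
   primitive T-th root of unity z, conjugates it over the complex numbers to
   the block diagonal matrix with blocks L + (z^k + z^-k) M, and taking
   z = exp(2 i pi / T) gives z^k + z^-k = 2 cos(2 k pi / T). Comparing
   characteristic polynomials yields the spectra with multiplicities. *)
Require Import Defs.
From HB Require Import structures.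
From mathcomp Require Import all_boot all_order all_algebra.
From mathcomp Require Import all_reals trigo.
From mathcomp Require Import complex.
From mathcomp Require Import lra.

Set Implicit Arguments.
Unset Strict Implicit.
Unset Printing Implicit Defensive.

Import Order.TTheory GRing.Theory Num.Theory.
Local Open Scope ring_scope.

(** The relation passes to ['X - A] and ['X - B] over polynomials; in determinants the nonzero
    constant [\det P] cancels. *)
Lemma char_poly_similar (F : fieldType) n (P A B : 'M[F]_n) :
  P \in unitmx -> A *m P = P *m B -> char_poly A = char_poly B.
Proof.
move=> Punit APB; have nzP : \det (map_mx polyC P) != 0.
  by rewrite det_map_mx polyC_eq0 -unitfE -unitmxE.
apply: (mulIf nzP); rewrite -det_mulmx [RHS]mulrC -det_mulmx.
by rewrite mulmxBl mulmxBr -!map_mxM APB scalar_mxC.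
Qed.

Lemma map_mxblock aT rT (f : aT -> rT) m n (p : 'I_m -> nat) (q : 'I_n -> nat)
    (B : forall i j, 'M[aT]_(p i, q j)) :
  map_mx f (\mxblock_(i, j) B i j) = \mxblock_(i, j) map_mx f (B i j).
Proof. by apply/matrixP=> s s'; rewrite !mxE. Qed.

Lemma map_mxdiag (U V : nmodType) (f : {additive U -> V}) m (p : 'I_m -> nat)
    (B : forall i, 'M[U]_(p i)) :
  map_mx f (\mxdiag_i B i) = \mxdiag_i map_mx f (B i).
Proof.
rewrite map_mxblock; apply/eq_mxblock => i j.
by case: eqP => [<-|_]; rewrite ?conform_mx_id ?map_mx0.
Qed.

Lemma det_castmx (R : comPzRingType) m n (e e' : m = n) (A : 'M[R]_m) :
  \det (castmx (e, e') A) = \det A.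
Proof. by case: n / e e' => e'; rewrite castmx_id. Qed.

Lemma det_mxdiag (R : comPzRingType) m (p : 'I_m -> nat)
    (B : forall i, 'M[R]_(p i)) :
  \det (\mxdiag_i B i) = \prod_i \det (B i).
Proof.
elim: m p B => [|m IHm] p B.
  (* The size is an empty sum; generalizing the block matrix allows rewriting it to 0 inside the
     type. *)
  rewrite [RHS]big_ord0; move: (\mxdiag_i B i); rewrite big_ord0 => A.
  exact: det_mx00.
by rewrite mxdiag_recl det_castmx det_ublock big_ord_recl IHm.
Qed.

Lemma char_poly_mxdiag (R : comNzRingType) m (p : 'I_m -> nat)
    (B : forall i, 'M[R]_(p i)) :
  char_poly (\mxdiag_i B i) = \prod_i char_poly (B i).
Proof.
by rewrite /char_poly /char_poly_mx map_mxdiag -mxdiagZ -mxdiagB det_mxdiag.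
Qed.

Lemma diag_invsqrt_mxdiag (R : realType) m (p : 'I_m -> nat)
    (B : forall i, 'M[R]_(p i)) :
  diag_invsqrt (\mxdiag_i B i) = \mxdiag_i diag_invsqrt (B i).
Proof.
rewrite /diag_invsqrt -diag_mxrow; congr diag_mx; apply/rowP=> s.
by rewrite !mxE eqxx conform_mx_id.
Qed.

Lemma diag_invsqrtK (R : realType) n (d : 'rV[R]_n) :
  (forall i, 0 < d 0 i) ->
  diag_invsqrt (diag_mx d) *m diag_mx d *m diag_invsqrt (diag_mx d) = 1%:M.
Proof.
move=> d_gt0; rewrite !mulmx_diag -diag_const_mx; congr diag_mx.
apply/rowP=> i; rewrite !mxE eqxx mulr1n -mulrA mulrCA -invfM -expr2.
by rewrite sqr_sqrtr ?ltW // divff // gt_eqF.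
Qed.

Lemma adjacent_layersE T (t p : 'I_T) :
  adjacent_layers t p = (p == ordS t) || (p == ord_pred t).
Proof.
rewrite /adjacent_layers (modn_small (ltn_ord p)) (modn_small (ltn_ord t)).
by rewrite -[p == ord_pred t](can_eq (@ordSK T)) ord_predK.
Qed.

Lemma iter_ordS_neq T k (t : 'I_T) : (0 < k < T)%N -> iter k (@ordS T) t != t.
Proof.
case/andP=> k_gt0 k_ltT.
have val_iter : iter k (@ordS T) t = ((t + k) %% T)%N :> nat.
  elim: k {k_gt0 k_ltT} => [|k IHk] /=; first by rewrite addn0 modn_small.
  by rewrite IHk -[in LHS]addn1 modnDml addn1 addnS.
apply: contraTneq k_gt0 => /(congr1 val) /=; rewrite val_iter => tk.
have: (t + k == t + 0 %[mod T])%N by rewrite tk addn0 modn_small.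
by rewrite eqn_modDl mod0n modn_small // -leqn0 leqNgt.
Qed.

(* T >= 3 makes t, t + 1 and t - 1 distinct modulo T, so no two terms overlap. *)
Lemma jacobi_blockE T n (V : nmodType) (L M : 'M[V]_n) (t p : 'I_T) :
  (3 <= T)%N ->
  (if t == p then L else if adjacent_layers t p then M else 0) =
  L *+ (p == t) + M *+ (p == ordS t) + M *+ (p == ord_pred t).
Proof.
move=> T_ge3.
have S1 : ordS t != t by apply: (@iter_ordS_neq _ 1); rewrite (leq_trans _ T_ge3).
have P1 : ord_pred t != t.
  by rewrite -(can_eq (@ordSK T)) ord_predK eq_sym.
(* Applying the injective [ordS] turns [t + 1 = t - 1] into [t + 2 = t], excluded by [2 < T]. *)
have S2 : ordS t != ord_pred t.
  by rewrite -(can_eq (@ordSK T)) ord_predK (@iter_ordS_neq _ 2).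
rewrite adjacent_layersE eq_sym; have [->|_] := eqVneq p t.
  by rewrite ![t == _]eq_sym (negPf S1) (negPf P1) !addr0.
have [->|_] := eqVneq p (ordS t); first by rewrite (negPf S2) add0r addr0.
by rewrite !add0r; case: eqP.
Qed.

Section BlockFourier.
Variables (F : fieldType) (T : nat) (z : F).
Hypothesis z_prim : T.-primitive_root z.

Lemma prim_root_neq0 : z != 0.
Proof.
apply: contra_eq_neq (prim_expr_order z_prim) => ->.
by rewrite expr0n gtn_eqF ?(prim_order_gt0 z_prim) // eq_sym oner_neq0.
Qed.

Definition fourier N : 'M[F]_(\sum_(t < T) N) :=
  \mxblock_(t < T, k < T) ((z ^+ (t * k))%:M : 'M_N).

(** Orthogonality of the characters of Z/T makes [G] below an inverse up to the factor [T]. *)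
Lemma fourier_unit N : fourier N \in unitmx.
Proof.
pose G : 'M[F]_(\sum_(t < T) N) :=
  \mxblock_(k < T, s < T) ((z ^- (k * s))%:M : 'M_N).
suffices FG : fourier N *m G = T%:R%:M.
  have : fourier N *m (T%:R^-1 *: G) = 1%:M.
    rewrite -scalemxAr FG scale_scalar_mx mulVf //.
    (* A primitive [T]-th root of unity in [F] prevents the characteristic from dividing [T]. *)
    exact: prim_root_natf_neq0 z_prim.
  by case/mulmx1_unit.
rewrite mul_mxblock -mxdiagZ; apply/eq_mxblock=> t s.
under eq_bigr do rewrite -scalar_mxM [(_ * s)%N]mulnC !exprM -exprVn -exprMn.
rewrite -(raddf_sum (@scalar_mx F N)); case: eqP => [<-|/eqP ts].
  rewrite conform_mx_id divff ?expf_neq0 ?prim_root_neq0 //.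
  by under eq_bigr do rewrite expr1n; rewrite sumr_const card_ord.
(* Off the diagonal stands a geometric sum whose ratio satisfies [x != 1] and [x ^+ T = 1], hence
   zero. *)
rewrite (_ : \sum_(i < T) _ = 0) ?raddf0 //; set x := z ^+ t / z ^+ s.
have x1 : x - 1 != 0.
  have zs_neq0 : z ^+ s != 0 by rewrite expf_neq0 ?prim_root_neq0.
  rewrite subr_eq0; apply: contra ts => /eqP/(canRL (mulfVK zs_neq0)).
  by rewrite mul1r => /eqP; rewrite (eq_prim_root_expr z_prim) !modn_small.
apply: (mulfI x1); rewrite mulr0 -subrX1 expr_div_n -!exprM.
by rewrite ![(_ * T)%N]mulnC !exprM (prim_expr_order z_prim) !expr1n divr1 subrr.
Qed.

(** Moving one layer up or down multiplies block column [k] of [fourier] by [z ^+ k] or [z ^- k], so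
    the block matrix acts on that column as [L + (z ^+ k + z ^- k) *: M]. *)
Lemma char_poly_jacobi N (L M : 'M[F]_N) :
  (3 <= T)%N ->
  char_poly (\mxblock_(t < T, p < T)
    (if t == p then L else if adjacent_layers t p then M else 0)) =
  \prod_(k < T) char_poly (L + (z ^+ k + z ^- k) *: M).
Proof.
move=> T_ge3.
rewrite -char_poly_mxdiag; apply: (char_poly_similar (fourier_unit N)).
rewrite mul_mxblock mul_mxblock_mxdiag; apply/eq_mxblock=> t k.
have zU : z \is a GRing.unit by rewrite unitfE prim_root_neq0.
(* The wrap-around of [ordS] is harmless because [z ^+ T = 1]. *)
have zS : z ^+ (ordS t * k) = z ^+ (t * k) * z ^+ k.
  rewrite -exprD -mulSnr /= -(prim_expr_mod z_prim) modnMml.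
  by rewrite (prim_expr_mod z_prim).
have zP : z ^+ (ord_pred t * k) = z ^+ (t * k) * z ^- k.
  apply: (canRL (mulrK (unitrX k zU))).
  rewrite -{2}[t]ord_predK /= -exprD -mulSnr.
  by rewrite -[RHS](prim_expr_mod z_prim) modnMml (prim_expr_mod z_prim).
have sum_delta (X : 'M[F]_N) (a : 'I_T) :
    \sum_p (X *+ (p == a)) *m (z ^+ (p * k))%:M = z ^+ (a * k) *: X.
  rewrite (bigD1 a) //= eqxx mul_mx_scalar big1 ?addr0 // => p /negPf->.
  by rewrite mul0mx.
under eq_bigr do rewrite jacobi_blockE // !mulmxDl.
rewrite !big_split /= !sum_delta zS zP mul_scalar_mx scalerDr scalerA mulrDr.
by rewrite scalerDl addrA.
Qed.

End BlockFourier.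

Section RootOfUnity.
Variable R : realType.

(** Euler's formula for exp(i x). *)
Definition expi (x : R) : R[i] := Complex (cos x) (sin x).

Lemma expi_exp x n : expi x ^+ n = expi (n%:R * x).
Proof.
elim: n => [|n IHn]; first by rewrite expr0 mul0r /expi cos0 sin0.
rewrite exprS IHn -natr1 mulrDl mul1r addrC /expi cosD sinD.
by congr Complex; rewrite addrC.
Qed.

Lemma expi_inv x : (expi x)^-1 = expi (- x).
Proof.
have xNx : expi (- x) * expi x = 1.
  rewrite /expi cosN sinN; congr Complex; last by rewrite mulrC mulNr addrN.
  by rewrite mulNr opprK -!expr2 cos2Dsin2.
have x_neq0 : expi x != 0.
  by apply: contra_eq_neq xNx => ->; rewrite mulr0 eq_sym oner_neq0.
by apply: (mulIf x_neq0); rewrite mulVf.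
Qed.

Lemma expi_neq1 x : 0 < x < pi *+ 2 -> expi x != 1.
Proof.
move=> /andP[x_gt0 x_lt]; apply/eqP=> -[cosx _].
(* Since x/2 lies in (0, pi), its sine is positive, whereas 1 = cos x = 2 cos^2(x/2) - 1 would make
   it vanish. *)
have: 0 < sin (x / 2).
  rewrite sin_gt0_pi // divr_gt0 //= ltr_pdivrMr //.
  by rewrite mulr_natr.
have := cos_mulr2n (x / 2); rewrite [x / 2 *+ 2]mulr2n -splitr cosx.
have := cos2Dsin2 (x / 2); nra.
Qed.

Lemma expi_prim T : (0 < T)%N -> T.-primitive_root (expi (2 * pi / T%:R)).
Proof.
move=> T_gt0; rewrite /primitive_root_of_unity T_gt0; apply/forallP=> k.
have T_gt0R : 0 < T%:R :> R by rewrite ltr0n.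
(* Primitivity tests the exponents [k.+1] from 1 to [T]; below [T] the angle stays strictly between
   0 and 2 pi. *)
rewrite unity_rootE expi_exp mulrCA; apply/eqP.
have [->|kT] := eqVneq k.+1 T.
  by rewrite divff ?lt0r_neq0 // mulr1 mulr_natl /expi cos2pi sin2pi eqxx.
apply/negbTE/expi_neq1.
have k_ltT : (k.+1 < T)%N by rewrite ltn_neqAle kT ltn_ord.
have pi2_gt0 : 0 < 2 * pi :> R by rewrite mulr_gt0 ?pi_gt0.
rewrite mulr_gt0 ?divr_gt0 // -[pi *+ 2]mulr_natl -[ltRHS]mulr1.
by rewrite ltr_pM2l // ltr_pdivrMr // mul1r ltr_nat.
Qed.

End RootOfUnity.

(** All layers share the same degrees, so the normalization acts block by block. *)
Lemma supra_laplacianE (R : realType) (N T : nat) (A : 'M[R]_N) (w : 'rV[R]_N) :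
  (forall i, 0 < degree A 0 i + 2 * w 0 i) ->
  supra_laplacian T A w =
  \mxblock_(t < T, p < T)
    (if t == p then layer_block A w
     else if adjacent_layers t p then interlayer_block A w else 0).
Proof.
move=> deg_gt0; rewrite /supra_laplacian /supra_adjacency diag_invsqrt_mxdiag.
rewrite -mxblockB mul_mxdiag_mxblock mul_mxblock_mxdiag.
apply/eq_mxblock=> t p; case: (t == p).
  rewrite conform_mx_id mulmxBr mulmxBl /layer_block; congr (_ - _).
  have -> : multidegree A w = diag_mx (\row_i (degree A 0 i + 2 * w 0 i)).
    by apply/matrixP=> i j; rewrite !mxE mulrnDl mulrnAr.
  (* Positivity matters here: at a nonpositive degree [Num.sqrt] and its inverse would be 0, leaving
     0 instead of 1 on the diagonal. *)
  by apply: diag_invsqrtK => i; rewrite mxE.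
rewrite sub0r mulmxN mulNmx; case: ifP => // _.
by rewrite mulmx0 mul0mx oppr0.
Qed.

Theorem theorem1 (R : realType) (N T : nat) (e : rel 'I_N) (w : 'rV[R]_N)
    (e_sym : symmetric e) (e_conn : connected_graph e)
    (deg_gt0 : forall i, 0 < degree (adjacency R e) 0 i + 2 * w 0 i)
    (T_ge3 : (3 <= T)%N) :
  perm_eq (spectrum (supra_laplacian T (adjacency R e) w))
    (flatten [seq spectrum (layer_block (adjacency R e) w
                 + (2 * cos (k%:R * (2 * pi / T%:R)))
                     *: interlayer_block (adjacency R e) w)
             | k <- iota 0 T]).
Proof.
have T_gt0 : (0 < T)%N by exact: leq_trans T_ge3.
(* A multiset of roots is determined by its product of linear factors. *)
apply: prod_XsubC_eq; rewrite big_flatten big_map -char_poly_spectrum.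
under eq_bigr do rewrite -char_poly_spectrum.
have -> : iota 0 T = index_iota 0 T by rewrite /index_iota subn0.
rewrite big_mkord supra_laplacianE // map_mxblock.
under eq_mxblock do rewrite !(fun_if (map_mx _)) map_mx0.
rewrite (char_poly_jacobi (expi_prim R T_gt0) _ _ T_ge3).
apply: eq_bigr => k _; congr char_poly; rewrite [RHS]map_mxD map_mxZ.
(* The two powers are complex conjugates: imaginary parts cancel and the cosines add up. *)
congr (_ + _ *: _); rewrite -exprVn expi_inv !expi_exp mulrN /expi cosN sinN.
by apply/eqP; rewrite eq_complex /= subrr [2 * cos _]mulr_natl mulr2n !eqxx.
Qed.
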